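(* If $X\subseteq 2^\omega$ is an uncountable saturated $\lambda'$-set, then $2^\omega\setminus X$ is a (completely) Baire countable dense homogeneous space; that is, $2^\omega\setminus X$ is countable dense homogeneous and is Baire, indeed completely Baire.
   Context: $2^\omega$ is the Cantor set of infinite binary sequences with the product topology. A subset $X$ of $2^\omega$ is a $\lambda'$-set if for every countable $Y\subseteq 2^\omega$, $Y$ is a relative $G_\delta$ subset of $X\cup Y$. For $x,y\in 2^\omega$ write $x\sim y$ (tail equivalence) if there are $m,n\in\omega$ such that $x(m+k)=y(n+k)$ for all $k\in\omega$. For $X\subseteq 2^\omega$ let $X^*=\{y\in 2^\omega:\exists x\in X\ (y\sim x)\}$; $X$ is saturated if $X=X^*$. A separable topological space $Z$ is countable dense homogeneous (CDH) if for any two countable dense subsets $D,E$ of $Z$ there is a homeomorphism $f\colon Z\to Z$ with $f[D]=E$. A space is completely Baire if all of its non-empty closed subspaces are Baire. *)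

(* Defs.v *)
From HB Require Import structures.
From mathcomp Require Import all_boot all_classical.
From mathcomp Require Import topology cantor borel_hierarchy.

Set Implicit Arguments.
Unset Strict Implicit.
Unset Printing Implicit Defensive.

Local Open Scope classical_set_scope.

(* A subset [A : set T] used as a type is [set_type A], whose canonical
   topology is the subspace topology (subtype_topology.v). *)

(* [countable] includes finite sets. *)
Definition lambda'_set (X : set cantor_space) : Prop :=
  forall Y : set cantor_space, countable Y ->
    Gdelta ((set_val : set_type (X `|` Y) -> cantor_space) @^-1` Y).

Definition tail_equiv (x y : cantor_space) : Prop :=
  exists m n : nat, forall k : nat, x (m + k)%N = y (n + k)%N.

Definition saturation (X : set cantor_space) : set cantor_space :=
  [set y | exists2 x, X x & tail_equiv y x].

Definition saturated (X : set cantor_space) : Prop := X = saturation X.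

Definition separable (Z : topologicalType) : Prop :=
  exists D : set Z, countable D /\ dense D.

Definition homeomorphism (Y Z : topologicalType) (f : Y -> Z) : Prop :=
  continuous f /\
  exists g : Z -> Y, [/\ cancel f g, cancel g f & continuous g].

Definition countable_dense_homogeneous (Z : topologicalType) : Prop :=
  separable Z /\
  forall D E : set Z, countable D -> dense D -> countable E -> dense E ->
    exists f : Z -> Z, homeomorphism f /\ f @` D = E.

Definition baire_space (Z : topologicalType) : Prop :=
  forall F : nat -> set Z, (forall i, open (F i) /\ dense (F i)) ->
    dense (\bigcap_i F i).

Definition completely_baire (Z : topologicalType) : Prop :=
  forall C : set Z, closed C -> C !=set0 -> baire_space (set_type C).

(* Main.v *)
(* Modifying a set of points only on finitely many coordinates keeps it
   countable, so a saturated lambda'-set [X] is avoided by a G_delta set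
   containing every point that is eventually equal to a point of D or E.  For
   points a, b there is an isometry of the Cantor space that sends a to b and
   changes only finitely many coordinates of any point other than a; it is the
   identity off the longest cylinder containing a and b.  A back-and-forth
   composition of such isometries, with supports shrinking inside the
   approximating open sets of the G_delta, converges to an isometry h with
   h(D) = E such that h and its inverse change only finitely many coordinates
   of each point of X; by saturation h preserves X.

   For complete Baireness, a countable dense subset of a closed subset C of the
   complement lies in a G_delta avoiding X, whose trace on the closure K of C in
   the Cantor space is comeagre in K; the Baire category theorem in K then gives
   points of K outside X, that is, points of C. *)
Require Import Defs.
From HB Require Import structures.
From mathcomp Require Import all_boot all_classical.
From mathcomp Require Import topology cantor borel_hierarchy.

Set Implicit Arguments.
Unset Strict Implicit.
Unset Printing Implicit Defensive.

Local Open Scope classical_set_scope.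
Local Open Scope card_scope.

(** * Agreement on initial segments and the topology it generates *)

Definition agree (k : nat) (x y : cantor_space) : Prop :=
  forall i, (i < k)%N -> x i = y i.

Lemma agree_sym k x y : agree k x y -> agree k y x.
Proof. by move=> xy i /xy ->. Qed.

Lemma agree_trans k y x z : agree k x y -> agree k y z -> agree k x z.
Proof. by move=> xy yz i ik; rewrite xy// yz. Qed.

Lemma agreeW k l x y : (k <= l)%N -> agree l x y -> agree k x y.
Proof. by move=> kl xy i ik; apply: xy; exact: leq_trans kl. Qed.

Lemma agree_eq x y : (forall k, agree k x y) -> x = y.
Proof. by move=> xy; apply/funext => i; exact: (xy i.+1). Qed.

Lemma agree_nbhs k x : nbhs x (agree k x).
Proof.
elim: k => [|k IHk]; first by apply: filterS filterT.
have xk : nbhs x ((fun y : cantor_space => y k) @^-1` [set x k]).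
  exact: (@proj_continuous _ (fun _ : nat => bool) k x _ (discrete_set1 (x k))).
apply: filterS (filterI IHk xk) => y [xy /= yk] i.
by rewrite ltnS leq_eqVlt => /predU1P[->//|]; exact: xy.
Qed.

(** If no cylinder around [x] were inside [U], points outside [U] in ever longer cylinders would
    converge to [x] coordinatewise, hence in the product topology. *)
Lemma cantor_nbhsP x (U : set cantor_space) :
  nbhs x U <-> exists k, agree k x `<=` U.
Proof.
split=> [xU|[k kU]]; last exact: filterS kU (agree_nbhs k x).
apply: contrapT => /forallNP noU.
have {}noU k : exists y, agree k x y /\ ~ U y.
  apply: contrapT => /forallNP ky; apply: (noU k) => y xy.
  by apply: contrapT => Uy; apply: (ky y).
have [u uP] := choice noU.
have ux : u @ \oo --> x.
  apply/cvg_sup => i V [_ [[W oW <-] Wxi WV]].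
  rewrite nbhs_simpl; exists i.+1 => // k /= ik; apply: WV => /=.
  by rewrite /= -(proj1 (uP k) i ik).
have [n _ /(_ n (leqnn n))] := ux _ xU.
exact: (proj2 (uP n)).
Qed.

Lemma cantor_openP (U : set cantor_space) :
  open U <-> forall x, U x -> exists k, agree k x `<=` U.
Proof.
by rewrite openE; split=> oU x /oU /cantor_nbhsP.
Qed.

Lemma isometry_continuous (h : cantor_space -> cantor_space) :
  (forall k x y, agree k x y -> agree k (h x) (h y)) -> continuous h.
Proof.
move=> hP x U /cantor_nbhsP[k kU]; apply/cantor_nbhsP; exists k => y xy.
by apply: kU; exact: hP.
Qed.

(** * Points differing in finitely many coordinates *)

Definition ev_eq (x y : cantor_space) : Prop :=
  exists N, forall i, (N <= i)%N -> x i = y i.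

Lemma ev_eq_sym x y : ev_eq x y -> ev_eq y x.
Proof. by move=> [N xy]; exists N => i /xy ->. Qed.

Lemma ev_eq_trans y x z : ev_eq x y -> ev_eq y z -> ev_eq x z.
Proof.
move=> [M xy] [N yz]; exists (maxn M N) => i; rewrite geq_max => /andP[Mi Ni].
by rewrite xy// yz.
Qed.

Lemma ev_eq_tail x y : ev_eq x y -> tail_equiv x y.
Proof. by move=> [N xy]; exists N, N => k; rewrite xy// leq_addr. Qed.

Definition overwrite (x : cantor_space) (w : seq bool) : cantor_space :=
  fun i => nth (x i) w i.

(** Finite words thus parametrise the class of [x], which makes it countable. *)
Lemma ev_eqP x y : ev_eq y x <-> exists w, y = overwrite x w.
Proof.
split=> [[N yx]|[w ->]]; last first.
  by exists (size w) => i wi; rewrite /overwrite nth_default.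
exists (mkseq y N); apply/funext => i; rewrite /overwrite.
have [iN|Ni] := ltnP i N; first by rewrite nth_mkseq.
by rewrite nth_default ?size_mkseq// yx.
Qed.

Lemma overwrite_agree k x y : agree k y (overwrite x (mkseq y k)).
Proof. by move=> i ik; rewrite /overwrite nth_mkseq. Qed.

Lemma countable_ev_eq (D : set cantor_space) : countable D ->
  countable [set y | exists2 x, D x & ev_eq y x].
Proof.
move=> cD; pose f (p : cantor_space * seq bool) := overwrite p.1 p.2.
have /sub_countable : [set y | exists2 x, D x & ev_eq y x] #<=
    (D `*` [set: seq bool]).
  apply: card_le_trans (card_image_le f _); apply: subset_card_le.
  move=> y [x Dx /ev_eqP[w ->]]; by exists (x, w).
by apply; apply: countableX.
Qed.

(** * Isometries of the Cantor space moving one point to another *)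

(* Flips by [a (+) b] the bits of [x] up to and including the first place where
   [x] and [a] differ. *)
Definition recenter (a b x : cantor_space) : cantor_space :=
  fun i => x i (+) (`[< agree i x a >] && (a i (+) b i)).

Section recenter.
Variables a b : cantor_space.

Lemma recenter_agree k x y :
  agree k x y -> agree k (recenter a b x) (recenter a b y).
Proof.
move=> xy i ik; rewrite /recenter xy//; congr (_ (+) (_ && _)).
have {}xy := agreeW (ltnW ik) xy.
apply/asbool_equiv_eq; split; apply: agree_trans => //; exact: agree_sym.
Qed.

Lemma recenter_center : recenter a b a = b.
Proof.
apply/funext => i; rewrite /recenter asboolT//=.
by case: (a i) (b i) => -[].
Qed.

(** By induction: while [x] follows [a], the guard in [recenter] holds, and
    [x i (+) (a i (+) b i) = b i] forces [x i = a i]. *)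
Lemma recenter_center_agree k x :
  agree k (recenter a b x) b <-> agree k x a.
Proof.
split=> [xb|xa]; last first.
  by rewrite -[X in agree _ _ X]recenter_center; exact: recenter_agree.
elim/ltn_ind => i IHi ik.
have /asboolT xai : agree i x a by move=> j ji; exact/IHi/(ltn_trans ji).
have := xb i ik; rewrite /recenter xai.
by case: (x i) (a i) (b i) => -[] [].
Qed.

(** A point that leaves [a] before place [k] can be flipped only below [k], where [a (+) b]
    vanishes. *)
Lemma recenter_id k x : agree k a b -> ~ agree k x a -> recenter a b x = x.
Proof.
move=> ab xa; apply/funext => i; rewrite /recenter.
have [/ab ->|ki] := ltnP i k; first by rewrite addbb andbF addbF.
rewrite asboolF ?addbF// => /(agreeW ki); exact: xa.
Qed.

Lemma recenter_near k x : agree k a b -> agree k (recenter a b x) x.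
Proof. by move=> ab i /ab abi; rewrite /recenter abi addbb andbF addbF. Qed.

Lemma recenter_ev_eq x : x <> a -> ev_eq (recenter a b x) x.
Proof.
move=> xa; have [k xka] : exists k, ~ agree k x a.
  by apply/existsNP => /agree_eq.
exists k => i ki; rewrite /recenter asboolF ?addbF// => /(agreeW ki).
exact: xka.
Qed.

End recenter.

(** By [recenter_center_agree] both maps evaluate the same guard, so each bit is flipped twice by
    the same amount. *)
Lemma recenterK a b : cancel (recenter a b) (recenter b a).
Proof.
move=> x; apply/funext => i; rewrite /recenter -!/(recenter a b _).
by rewrite (asbool_equiv_eq (recenter_center_agree a b i x)) [b i (+) _]addbC
  -addbA addbb addbF.
Qed.

Lemma agree_separate x (s : seq cantor_space) : x \notin s ->
  exists k, forall y, y \in s -> ~ agree k x y.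
Proof.
elim: s => [|z s IHs]; first by exists 0%N.
rewrite inE negb_or => /andP[/eqP xz /IHs[k kP]].
have [l xlz] : exists l, ~ agree l x z by apply/existsNP => /agree_eq.
exists (maxn k l) => y; rewrite inE => /predU1P[->|/kP xky].
  by move=> /(agreeW (leq_maxr _ _)).
by move=> /(agreeW (leq_maxl _ _)).
Qed.

(** * Finite stages of the back-and-forth *)

Record approx := Approx {
  fw : cantor_space -> cantor_space;
  bw : cantor_space -> cantor_space;
  matched : seq (cantor_space * cantor_space) }.

(** [matched] lists the finitely many pairs already settled; their first components are the only
    points that [fw s] may change at infinitely many coordinates. *)
Record approx_for (D E : set cantor_space) (s : approx) : Prop := ApproxFor {
  fwK : cancel (fw s) (bw s);
  bwK : cancel (bw s) (fw s);
  fw_agree : forall k x y, agree k x y -> agree k (fw s x) (fw s y);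
  bw_agree : forall k x y, agree k x y -> agree k (bw s x) (bw s y);
  matchedP : forall d e, (d, e) \in matched s -> [/\ D d, E e & fw s d = e];
  fw_ev_eq : forall x,
    ev_eq (fw s x) x \/ exists e, (x, e) \in matched s }.

(** The [near] fields make the coordinatewise limits exist; the [fix] fields confine later changes
    of both maps to [W]. *)
Record extends (W : set cantor_space) (n : nat) (s t : approx) : Prop :=
  Extends {
  matched_sub : {subset matched s <= matched t};
  fw_near : forall x, agree n (fw t x) (fw s x);
  bw_near : forall x, agree n (bw t x) (bw s x);
  fw_fix : forall x, ~ W x -> fw t x = fw s x;
  bw_fix : forall x, ~ W x -> bw t x = bw s x }.

Lemma extends_refl W n s : extends W n s s.
Proof. by split. Qed.

Lemma extends_trans W n t s u :
  extends W n s t -> extends W n t u -> extends W n s u.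
Proof.
move=> [st1 st2 st3 st4 st5] [tu1 tu2 tu3 tu4 tu5]; split.
- by move=> p /st1 /tu1.
- by move=> x; apply: (agree_trans (tu2 x) (st2 x)).
- by move=> x; apply: (agree_trans (tu3 x) (st3 x)).
- by move=> x Wx; rewrite tu4// st4.
- by move=> x Wx; rewrite tu5// st5.
Qed.

(** Exchanging the two directions lets the back step reuse the forth step with [D] and [E]
    swapped. *)
Definition flip (s : approx) : approx :=
  Approx (bw s) (fw s) [seq (p.2, p.1) | p <- matched s].

Lemma matched_flip s d e :
  ((e, d) \in matched (flip s)) = ((d, e) \in matched s).
Proof.
apply/mapP/idP => [[[x y] xy [-> ->]]//|de]; by exists (d, e).
Qed.

Lemma approx_for_flip D E s : approx_for D E s -> approx_for E D (flip s).
Proof.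
move=> [sK sK' sA sA' sM sE]; split=> //=.
- by move=> e d; rewrite matched_flip => /sM[Dd Ee de]; rewrite -de sK de.
- move=> y; have [|[e bye]] := sE (bw s y).
    by rewrite sK' => /ev_eq_sym; left.
  right; exists (bw s y); rewrite matched_flip.
  by have [_ _] := sM _ _ bye; rewrite sK' => ye; rewrite -ye in bye.
Qed.

Lemma extends_flip W n s t : extends W n s t -> extends W n (flip s) (flip t).
Proof.
move=> [st1 st2 st3 st4 st5]; split=> //= -[e d].
by rewrite !matched_flip => /st1.
Qed.

Lemma flipK : involutive flip.
Proof.
move=> [f g m]; congr Approx => /=; rewrite -map_comp -[RHS]map_id.
by apply: eq_map => -[].
Qed.

(** The image of an unmatched [d] is moved to a point [e] of [E] by one [recenter] applied after
    [fw s]; all requirements reduce to taking [e] close enough. *)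
Lemma match_point (D E W : set cantor_space) n s d :
  open W -> (forall x k, exists2 e, E e & agree k x e) ->
  D d -> (forall x, ev_eq x d -> W x) -> approx_for D E s ->
  exists t, [/\ approx_for D E t, extends W n s t &
    exists e, (d, e) \in matched t].
Proof.
move=> oW dE Dd Wd Is.
have [dM|ndM] := pselect (exists e, (d, e) \in matched s).
  by exists s; split=> //; exact: extends_refl.
have sd : ev_eq (fw s d) d by case: (fw_ev_eq Is d).
have [sK sK' sA sA' sM sE] := Is.
have /cantor_openP oWP := oW.
have [k1 k1W] := oWP _ (Wd _ (ex_intro _ 0%N (fun _ _ => erefl))).
have [k2 k2W] := oWP _ (Wd _ sd).
(* Since [fw s] is injective and [d] is unmatched, [fw s d] differs from every value already
   used. *)
have [k3 k3M] : exists k, forall y, y \in [seq p.2 | p <- matched s] ->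
    ~ agree k (fw s d) y.
  apply: agree_separate; apply/negP => /mapP[[x y] xy /= dy].
  have [_ _] := sM _ _ xy; rewrite -dy => /(can_inj sK) xd.
  by apply: ndM; exists y; rewrite -xd.
(* Here [n] protects the earlier coordinates, [k1] and [k2] keep the changes of the forward and
   inverse maps inside [W], and [k3] protects the matched values. *)
pose k := maxn (maxn n k1) (maxn k2 k3).
have [nk k1k k2k k3k] : [/\ n <= k, k1 <= k, k2 <= k & k3 <= k]%N.
  by rewrite /k !leq_max !leqnn !orbT.
have [e Ee de] := dE (fw s d) k.
pose t := Approx (recenter (fw s d) e \o fw s) (bw s \o recenter e (fw s d))
  ((d, e) :: matched s).
have ed := agree_sym de.
exists t; split; last by exists e; rewrite inE eqxx.
- split=> /=.
  + by move=> x /=; rewrite recenterK sK.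
  + by move=> x /=; rewrite sK' recenterK.
  + by move=> l x y xy; apply: recenter_agree; exact: sA.
  + by move=> l x y xy; apply: sA'; exact: recenter_agree.
  + move=> x y; rewrite inE => /predU1P[[-> ->]|xy].
      by split=> //; exact: recenter_center.
    have [Dx Ey xye] := sM _ _ xy; split=> //=; rewrite xye.
    apply: (recenter_id de) => /agree_sym /(agreeW k3k).
    by apply: k3M; apply/mapP; exists (x, y).
  + move=> x; have [->|xd] := eqVneq x d.
      by right; exists e; rewrite inE eqxx.
    have [sx|[y xy]] := sE x; last by right; exists y; rewrite inE xy orbT.
    left; apply: ev_eq_trans sx; apply: recenter_ev_eq => /(can_inj sK).
    exact/eqP.
- split=> /=.
  + by move=> p pM; rewrite inE pM orbT.
  + by move=> x; apply: (agreeW nk _); exact: recenter_near.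
  + by move=> x; apply: (agreeW nk _); apply: sA'; exact: recenter_near.
  + move=> x Wx; apply: (recenter_id de) => /sA'; rewrite !sK => xd.
    by apply: Wx; apply: k1W; apply/agree_sym/(agreeW k1k).
  + move=> x Wx; congr (bw s _); apply: (recenter_id ed) => xe.
    apply: Wx; apply: k2W; apply/(agreeW k2k).
    exact/agree_sym/(agree_trans xe).
Qed.

(** By injectivity of [f] and [g], at most one point of [D] and one of [E] has code [n]: one forth
    step and one back step suffice. *)
Lemma match_stage (D E W : set cantor_space) n s (f g : cantor_space -> nat) :
  open W ->
  (forall x k, exists2 d, D d & agree k x d) ->
  (forall x k, exists2 e, E e & agree k x e) ->
  {in D &, injective f} -> {in E &, injective g} ->
  (forall x y, D x \/ E x -> ev_eq y x -> W y) -> approx_for D E s ->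
  exists t, [/\ approx_for D E t, extends W n s t,
    forall d, D d -> f d = n -> exists e, (d, e) \in matched t &
    forall e, E e -> g e = n -> exists d, (d, e) \in matched t].
Proof.
move=> oW dD dE injf injg DEW Is.
have [t [It st tD]] : exists t, [/\ approx_for D E t, extends W n s t &
    forall d, D d -> f d = n -> exists e, (d, e) \in matched t].
  have [[d0 Dd0 d0n]|nod] := pselect (exists2 d, D d & f d = n); last first.
    exists s; split=> //; first exact: extends_refl.
    by move=> d Dd dn; exfalso; apply: nod; exists d.
  have [t [It st d0t]] := match_point n oW dE Dd0
    (fun y => DEW _ y (or_introl Dd0)) Is.
  exists t; split=> // d Dd dn.
  by rewrite (injf d d0) ?inE// dn.
have [[e0 Ee0 e0n]|noe] := pselect (exists2 e, E e & g e = n); last first.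
  exists t; split=> //.
  by move=> e Ee en; exfalso; apply: noe; exists e.
have [u [Iu tu [d0 e0u]]] := match_point n oW dD Ee0
  (fun y => DEW _ y (or_intror Ee0)) (approx_for_flip It).
have {}tu : extends W n t (flip u).
  by rewrite -(flipK t); exact: extends_flip.
exists (flip u); split.
- exact: approx_for_flip.
- exact: extends_trans st tu.
- by move=> d Dd /(tD d Dd)[e de]; exists e; exact: (matched_sub tu).
- move=> e Ee en; exists d0; rewrite matched_flip.
  by rewrite (injg e e0) ?inE// en.
Qed.

(** * The limit of the stages *)

Lemma back_and_forth (D E : set cantor_space) (W : nat -> set cantor_space) :
  countable D -> countable E ->
  (forall x k, exists2 d, D d & agree k x d) ->
  (forall x k, exists2 e, E e & agree k x e) ->
  (forall n, open (W n)) -> (forall n, W n.+1 `<=` W n) ->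
  (forall n x y, D x \/ E x -> ev_eq y x -> W n y) ->
  exists h g : cantor_space -> cantor_space,
  [/\ cancel h g /\ cancel g h,
    forall k x y, agree k x y -> agree k (h x) (h y),
    forall k x y, agree k x y -> agree k (g x) (g y),
    (forall d, D d -> E (h d)) /\ (forall e, E e -> D (g e)) &
    forall n x, ~ W n x -> ev_eq (h x) x /\ ev_eq (g x) x].
Proof.
move=> /countable_injP[f injf] /countable_injP[g injg] dD dE oW decW DEW.
(* Validity of the current stage is a premise under the existential, so that choice yields a total
   successor function. *)
have step (p : nat * approx) : exists t, approx_for D E p.2 ->
    [/\ approx_for D E t, extends (W p.1) p.1 p.2 t,
    forall d, D d -> f d = p.1 -> exists e, (d, e) \in matched t &
    forall e, E e -> g e = p.1 -> exists d, (d, e) \in matched t].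
  have [Is|nIs] := pselect (approx_for D E p.2); last by exists p.2.
  have [t tP] := match_stage p.1 (oW _) dD dE injf injg
    (DEW p.1) Is.
  by exists t.
have [next nextP] := choice step.
pose s := fix s n := if n is m.+1 then next (m, s m) else Approx id id [::].
have sI n : approx_for D E (s n).
  elim: n => [|n /(nextP (n, s n))[]//].
  by split=> // x; left; exists 0%N.
have sS n := nextP (n, s n) (sI n).
have sE m n : (m <= n)%N -> extends (W m) m (s m) (s n).
  move=> mn; rewrite -(subnKC mn); elim: (n - m)%N => [|j IHj].
    by rewrite addn0; exact: extends_refl.
  apply: extends_trans IHj _; rewrite addnS.
  have [_ [s1 s2 s3 s4 s5] _ _] := sS (m + j)%N.
  have WW : W (m + j)%N `<=` W m.
    elim: j {s1 s2 s3 s4 s5} => [|j IHj]; rewrite ?addn0// addnS => x.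
    by move=> /decW /IHj.
  split=> // x.
  - exact: (agreeW (leq_addr j m) (s2 x)).
  - exact: (agreeW (leq_addr j m) (s3 x)).
  - by move=> Wx; apply: s4 => /WW.
  - by move=> Wx; apply: s5 => /WW.
(* All stages from [i.+1] on agree at coordinate [i], so this diagonal is the coordinatewise
   limit. *)
pose h (x : cantor_space) : cantor_space := fun i => fw (s i.+1) x i.
pose h' (x : cantor_space) : cantor_space := fun i => bw (s i.+1) x i.
have hP n x : agree n (h x) (fw (s n) x).
  move=> i ni; have [_ st _ _ _] := sE _ _ ni.
  by rewrite /h st.
have hP' n x : agree n (h' x) (bw (s n) x).
  move=> i ni; have [_ _ st _ _] := sE _ _ ni.
  by rewrite /h' st.
have hA k x y : agree k x y -> agree k (h x) (h y).
  move=> xy; apply: (agree_trans (hP k x) _).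
  apply: (agree_trans _ (agree_sym (hP k y))).
  exact: (fw_agree (sI k) xy).
have hA' k x y : agree k x y -> agree k (h' x) (h' y).
  move=> xy; apply: (agree_trans (hP' k x) _).
  apply: (agree_trans _ (agree_sym (hP' k y))).
  exact: (bw_agree (sI k) xy).
have hK : cancel h h'.
  move=> x; apply: agree_eq => k; apply: (agree_trans (hP' k _) _).
  rewrite -[X in agree _ _ X](fwK (sI k) x).
  exact: (bw_agree (sI k) (hP k x)).
have hK' : cancel h' h.
  move=> x; apply: agree_eq => k; apply: (agree_trans (hP k _) _).
  rewrite -[X in agree _ _ X](bwK (sI k) x).
  exact: (fw_agree (sI k) (hP' k x)).
have hM n d e : (d, e) \in matched (s n) -> h d = e.
  move=> de; apply: agree_eq => k.
  apply: (agreeW (leq_maxr n k) _); apply: (agree_trans (hP _ _) _).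
  have /(matchedP (sI _))[_ _ ->//] := matched_sub (sE _ _ (leq_maxl n k)) de.
exists h, h'; split=> //.
  split=> [d Dd|e Ee].
    have [_ _ /(_ d Dd erefl)[e de] _] := sS (f d).
    rewrite (hM (f d).+1 d e de).
    by have [] := matchedP (sI (f d).+1) de.
  have [_ _ _ /(_ e Ee erefl)[d de]] := sS (g e).
  rewrite -(hM (g e).+1 d e de) hK.
  by have [] := matchedP (sI (g e).+1) de.
(* Off [W n] nothing changes after stage [n], so both limits equal that stage at [x]; as [D] and [E]
   lie in [W n], [x] is unmatched and changes only finitely. *)
move=> n x Wx.
have hx : h x = fw (s n) x.
  apply: agree_eq => k; apply: (agreeW (leq_maxr n k) _).
  apply: (agree_trans (hP _ _) _).
  by rewrite (fw_fix (sE _ _ (leq_maxl n k)) Wx).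
have hx' : h' x = bw (s n) x.
  apply: agree_eq => k; apply: (agreeW (leq_maxr n k) _).
  apply: (agree_trans (hP' _ _) _).
  by rewrite (bw_fix (sE _ _ (leq_maxl n k)) Wx).
have nDE : ~ (D x \/ E x).
  by move=> DEx; apply/Wx/(DEW n x x DEx); exists 0%N.
split.
  rewrite hx; have [//|[e xe]] := fw_ev_eq (sI n) x.
  by exfalso; apply: nDE; left; have [] := matchedP (sI n) xe.
rewrite hx'; have [//|[e xe]] := fw_ev_eq (approx_for_flip (sI n)) x.
exfalso; apply: nDE; right; rewrite matched_flip in xe.
by have [] := matchedP (sI n) xe.
Qed.

(** * Baire category inside a set avoiding [X] *)

(** This is the Baire category theorem in the closed set [K]: cylinders centred in [K] shrink into
    the successive [U n], and their centres converge. *)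
Lemma nested_cylinders (K : set cantor_space) (U : nat -> set cantor_space) :
  (forall x, (forall k, exists2 y, K y & agree k x y) -> K x) ->
  (forall n, open (U n)) ->
  (forall n x k, K x -> exists y, [/\ K y, agree k x y & U n y]) ->
  forall x k, K x -> exists z, [/\ K z, agree k x z & forall n, U n z].
Proof.
move=> clK oU dU x k Kx.
have step (p : nat * (cantor_space * nat)) : exists q : cantor_space * nat,
    K p.2.1 -> [/\ K q.1, agree p.2.2 p.2.1 q.1, (p.2.2 < q.2)%N &
    agree q.2 q.1 `<=` U p.1].
  case: p => n [y l] /=.
  have [Ky|nKy] := pselect (K y); last by exists (y, l).
  have [z [Kz yz /(proj1 (cantor_openP _) (oU n))[m mU]]] := dU n y l Ky.
  exists (z, maxn l.+1 m); split=> //=; first exact: leq_maxl.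
  by move=> w zw; apply: mU; exact: (agreeW (leq_maxr _ _) zw).
have [next nextP] := choice step.
pose s := fix s n := if n is m.+1 then next (m, s m) else (x, k).
have sK n : K (s n).1 by elim: n => // n /(nextP (n, s n))[].
have sS n := nextP (n, s n) (sK n).
have sle m n : (m <= n)%N -> ((s m).2 <= (s n).2)%N.
  move=> mn; rewrite -(subnKC mn); elim: (n - m)%N => [|j IHj].
    by rewrite addn0.
  by rewrite addnS; apply: leq_trans IHj _; have [_ _ /ltnW] := sS (m + j)%N.
have sn n : (n <= (s n).2)%N.
  by elim: n => // n IHn; have [_ _ + _] := sS n; exact: leq_ltn_trans.
have sA m n : (m <= n)%N -> agree (s m).2 (s m).1 (s n).1.
  move=> mn; rewrite -(subnKC mn); elim: (n - m)%N => [|j IHj].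
    by rewrite addn0.
  rewrite addnS; apply: (agree_trans IHj _); have [_ sj _ _] := sS (m + j)%N.
  by apply: (agreeW _ sj); apply: sle; exact: leq_addr.
pose z : cantor_space := fun i => (s i.+1).1 i.
have sz n : agree (s n).2 (s n).1 z.
  move=> i isn; rewrite /z; have [ni|ni] := leqP n i.+1; first exact: sA.
  by apply/esym; apply: (sA _ _ (ltnW ni)); exact: sn.
exists z; split; [|exact: (sz 0%N)|].
  apply: clK => l; exists (s l).1 => //.
  by apply/agree_sym; apply: (agreeW (sn l) (sz l)).
move=> n; have [_ _ _] := sS n; apply; exact: (sz n.+1).
Qed.

(** The [G n] are open extensions of the relatively open sets that cut [S] out of the union of [X]
    and [S]; a point of [X] in all of them would lie in [S]. *)
Lemma lambda'_Gdelta_avoid (X S : set cantor_space) :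
  lambda'_set X -> countable S -> S `<=` ~` X ->
  exists G : nat -> set cantor_space, [/\ forall n, open (G n),
    forall n, S `<=` G n & forall x, X x -> exists n, ~ G n x].
Proof.
move=> lX cS SX; have [F oF SF] := lX S cS.
have {}oF n : exists V : set cantor_space, open V /\ set_val @^-1` V = F n.
  by have [V oV VF] := oF n; exists V.
have [G GP] := choice oF.
exists G; split=> [n|n x Sx|x Xx].
- by have [] := GP n.
- pose x' : set_type (X `|` S) := exist _ x (mem_set (or_intror Sx)).
  have : (\bigcap_i F i) x' by rewrite -SF.
  by move=> /(_ n I); have [_ <-] := GP n.
- pose x' : set_type (X `|` S) := exist _ x (mem_set (or_introl Xx)).
  apply: contrapT => /forallNP Gx.
  suff : (\bigcap_i F i) x' by rewrite -SF => /SX.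
  move=> n _; have [_ <-] := GP n; apply: contrapT; exact: Gx.
Qed.

(** Here [f] induces the topology of [Z] and its range is closed relative to the complement of [X];
    the complement and its closed subspaces are both instances. *)
Lemma baire_embedding (Z : topologicalType) (f : Z -> cantor_space)
    (X : set cantor_space) :
  lambda'_set X ->
  (forall U : set Z, open U <-> exists2 V, open V & f @^-1` V = U) ->
  (forall z, ~ X (f z)) ->
  (forall x, ~ X x -> (forall k, exists z, agree k x (f z)) ->
    exists z, f z = x) ->
  baire_space Z.
Proof.
move=> lX openZ fX clf F oF O [z0 Oz0] /openZ[O' oO' OO'].
have oFU n : exists U : set cantor_space, open U /\ f @^-1` U = F n.
  by have [/openZ[U oU UF] _] := oF n; exists U.
have [U UP] := choice oFU.
(* The equation says that [w] is a prefix of [f z]; words that are never a prefix get the default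
   [z0]. One point per word makes [S] countable and dense in the range. *)
pose p (w : seq bool) : Z := xget z0 [set z | overwrite (f z) w = f z].
pose S := range (f \o p).
have cS : countable S.
  exact: sub_countable (card_image_le _ _) (countableP _).
have SX : S `<=` ~` X by move=> _ [w _ <-]; exact: fX.
have Sdense k z : exists2 y, S y & agree k (f z) y.
  exists (f (p (mkseq (f z) k))); first by exists (mkseq (f z) k).
  have : [set y | overwrite (f y) (mkseq (f z) k) = f y] (p (mkseq (f z) k)).
    rewrite /p; apply: (@xgetPex _ z0); exists z => /=; apply/esym.
    apply/agree_eq => j i ij; rewrite /overwrite.
    have [ik|ki] := ltnP i k; first by rewrite nth_mkseq.
    by rewrite nth_default// size_mkseq.
  by move=> /= <-; exact: overwrite_agree.
have [G [oG SG GX]] := lambda'_Gdelta_avoid lX cS SX.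
(* [K] is the closure of the range of [f] in the Cantor space. *)
pose K := [set x | forall k, exists z, agree k x (f z)].
have fK z : K (f z) by move=> k; exists z.
have clK x : (forall k, exists2 y, K y & agree k x y) -> K x.
  move=> xK k; have [y /(_ k)[z yz] xy] := xK k.
  by exists z; exact: (agree_trans xy yz).
have oUG n : open (U n `&` G n) by apply: openI; [have [] := UP n|exact: oG].
(* Density of [F n] gives a point of the range in the open set [U n]; a point of [S] close to it
   stays in [U n] and lies in [G n]. *)
have dUG n x k : K x -> exists y, [/\ K y, agree k x y & (U n `&` G n) y].
  move=> /(_ k)[z1 xz1].
  have [z2 [z12 Fz2]] : (f @^-1` (agree k (f z1)) `&` F n) !=set0.
    have [_ dF] := oF n; apply: dF; first by exists z1.
    apply/openZ; exists (agree k (f z1)) => //.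
    apply/cantor_openP => y ?; exists k => w; exact: agree_trans.
  have [l lU] : exists l, agree l (f z2) `<=` U n.
    have [oU UF] := UP n; apply: (proj1 (cantor_openP _) oU).
    by rewrite -UF in Fz2.
  have [y Sy z2y] := Sdense (maxn k l) z2; exists y; split.
  - by have [w _ <-] := Sy; exact: fK.
  - apply: (agree_trans xz1 _); apply: (agree_trans z12 _).
    exact: (agreeW (leq_maxl _ _) z2y).
  - by split; [apply: lU; exact: (agreeW (leq_maxr _ _) z2y)|exact: SG].
have [k kO] : exists k, agree k (f z0) `<=` O'.
  by apply: (proj1 (cantor_openP _) oO'); rewrite -OO' in Oz0.
have [x [Kx z0x UGx]] := nested_cylinders clK oUG dUG k (fK z0).
(* Lying in every [G n], [x] avoids [X], so relative closedness puts it back in the range. *)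
have [z zx] : exists z, f z = x.
  by apply: clf => // /GX[n]; apply; have [] := UGx n.
exists z; split; first by rewrite -OO' /= zx; exact: kO.
by move=> n _; have [_ <-] := UP n; rewrite /= zx; have [] := UGx n.
Qed.

Lemma saturated_ev_eq (X : set cantor_space) x y :
  saturated X -> ev_eq y x -> X x -> X y.
Proof.
by move=> satX yx Xx; rewrite satX; exists x => //; exact: ev_eq_tail.
Qed.

(** * The complement of a saturated lambda'-set *)

Section complement.
Variables (X : set cantor_space).
Hypotheses (satX : saturated X) (lX : lambda'_set X).
Local Notation Y := (set_type (~` X)).

Lemma complement_ev_eq x y : ev_eq y x -> ~ X x -> ~ X y.
Proof. by move=> /ev_eq_sym xy Xx /(saturated_ev_eq satX xy). Qed.

Definition in_complement x (Xx : ~ X x) : Y := exist _ x (mem_set Xx).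

(** Replacing a prefix of [y0] stays outside [X], so the complement meets every cylinder and its
    dense subsets are dense in the whole Cantor space. *)
Lemma complement_dense_agree (D : set Y) (y0 : Y) : dense D ->
  forall x k, exists2 d, (set_val @` D) d & agree k x d.
Proof.
move=> dD x k.
have [y [xy Dy]] : ([set y : Y | agree k x (set_val y)] `&` D) !=set0.
  apply: dD.
    have ov : ~ X (overwrite (set_val y0) (mkseq x k)).
      apply: (@complement_ev_eq (set_val y0)); last exact: (set_valP y0).
      by apply/ev_eqP; exists (mkseq x k).
    by exists (in_complement ov); exact: overwrite_agree.
  exists (agree k x) => //.
  by apply/cantor_openP => y ?; exists k => w; exact: agree_trans.
by exists (set_val y) => //; exists y.
Qed.

Lemma complement_separable : separable Y.
Proof.
have [[y0 _]|Y0] := pselect ([set: Y] !=set0); last first.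
  by exists set0; split=> // O [y _]; exfalso; apply: Y0; exists y.
(* By saturation, all finite modifications of [y0] stay in the complement. *)
pose S := [set y | exists2 x, [set set_val y0] x & ev_eq y x].
exists (set_val @^-1` S); split.
  have cS : countable S by apply: countable_ev_eq; exact: countable1.
  apply: sub_countable cS.
  have /card_esym/card_eqPle[+ _] :
      set_val @` (set_val @^-1` S : set Y) #= (set_val @^-1` S : set Y).
    by apply: inj_card_eq => x y _ _; exact: val_inj.
  move=> /card_le_trans; apply; apply: subset_card_le.
  exact: image_preimage_subset.
move=> O [y Oy] [O' oO' OO'].
have [k kO] : exists k, agree k (set_val y) `<=` O'.
  by apply: (proj1 (cantor_openP _) oO'); rewrite -OO' in Oy.
have Sov : ev_eq (overwrite (set_val y0) (mkseq (set_val y) k)) (set_val y0).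
  by apply/ev_eqP; exists (mkseq (set_val y) k).
exists (in_complement (complement_ev_eq Sov (set_valP y0))); split.
  by rewrite -OO'; apply: kO; exact: overwrite_agree.
by exists (set_val y0).
Qed.

Lemma complement_baire : baire_space Y.
Proof.
apply: (@baire_embedding _ (set_val : Y -> cantor_space) X) => //.
- by move=> z; exact: (set_valP z).
- by move=> x Xx _; exists (in_complement Xx).
Qed.

Lemma complement_completely_baire : completely_baire Y.
Proof.
move=> C clC _.
apply: (@baire_embedding _ (fun z : set_type C => set_val (set_val z)) X) => //.
- move=> U; split.
    by move=> [V [V' oV' <-] <-]; exists V'.
  by move=> [V oV <-]; exists (set_val @^-1` V) => //; exists V.
- by move=> z; exact: (set_valP (set_val z)).
- move=> x Xx xC; have Cx : C (in_complement Xx).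
    apply: clC => B [_ [[V oV <-] Vx] VB].
    have [k kV] := proj1 (cantor_openP _) oV _ Vx.
    have [z xz] := xC k; exists (set_val z); split; first exact: (set_valP z).
    by apply: VB; exact: kV.
  by exists (exist _ (in_complement Xx) (mem_set Cx)).
Qed.

Definition restrict_complement (h : cantor_space -> cantor_space)
  (hX : forall x, ~ X x -> ~ X (h x)) (y : Y) : Y :=
  in_complement (hX _ (set_valP y)).

Lemma restrict_complement_continuous h (hX : forall x, ~ X x -> ~ X (h x)) :
  continuous h -> continuous (restrict_complement hX).
Proof.
move=> /continuousP ch; apply/continuousP => _ [V oV <-].
by exists (h @^-1` V); first exact: ch.
Qed.

Lemma complement_homogeneous (D E : set Y) :
  countable D -> dense D -> countable E -> dense E ->
  exists f : Y -> Y, homeomorphism f /\ f @` D = E.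
Proof.
move=> cD dD cE dE.
(* An empty complement is treated apart, because the density argument needs a point [y0]. *)
have [[y0 _]|Y0] := pselect ([set: Y] !=set0); last first.
  have idC : continuous (id : Y -> Y) by move=> y; exact: cvg_id.
  exists id; split; first by split=> //; exists id.
  by apply/seteqP; split=> y; exfalso; apply: Y0; exists y.
pose D' : set cantor_space := set_val @` D.
pose E' : set cantor_space := set_val @` E.
have cD' : countable D' by exact: sub_countable (card_image_le _ _) cD.
have cE' : countable E' by exact: sub_countable (card_image_le _ _) cE.
pose S := [set y | exists2 x, (D' `|` E') x & ev_eq y x].
have cS : countable S.
  apply: countable_ev_eq; rewrite -bigcup2E.
  by apply: bigcup_countable => // -[|[|n]].
have SX : S `<=` ~` X.
  move=> y [_ [[d _ <-]|[e _ <-]] /complement_ev_eq]; apply.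
    exact: (set_valP d).
  exact: (set_valP e).
have [G [oG SG GX]] := lambda'_Gdelta_avoid lX cS SX.
(* Partial intersections give the decreasing sequence that [back_and_forth] requires, and each point
   of [X] still leaves it. *)
pose W := fix W n := if n is m.+1 then W m `&` G m else setT.
have oW n : open (W n).
  by elim: n => [|n IHn]; [exact: openT|apply: openI].
have SW n : S `<=` W n.
  by elim: n => // n IHn x Sx; split; [exact: IHn|exact: SG].
have WX x : X x -> exists n, ~ W n x.
  by move=> /GX[n nG]; exists n.+1 => -[_].
have [//|//|||//|||h [g [[hK gK] hA gA [hD gE] hgX]]] :=
  @back_and_forth D' E' W.
- exact: (complement_dense_agree y0).
- exact: (complement_dense_agree y0).
- by move=> n x [].
- by move=> n x y DEx yx; apply: SW; exists x.
(* If [h x] were in [X], then [g] would change it only finitely, and saturation would put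
   [x = g (h x)] in [X]. *)
have hX x : ~ X x -> ~ X (h x).
  move=> Xx Xhx; have [n nW] := WX _ Xhx; have [_] := hgX n _ nW.
  by rewrite hK => xhx; apply: Xx; exact: saturated_ev_eq xhx Xhx.
have gX x : ~ X x -> ~ X (g x).
  move=> Xx Xgx; have [n nW] := WX _ Xgx; have [+ _] := hgX n _ nW.
  by rewrite gK => xhx; apply: Xx; exact: saturated_ev_eq xhx Xgx.
exists (restrict_complement hX); split.
  split; first exact/restrict_complement_continuous/isometry_continuous.
  exists (restrict_complement gX); split.
  - by move=> y; apply: val_inj; exact: hK.
  - by move=> y; apply: val_inj; exact: gK.
  - exact/restrict_complement_continuous/isometry_continuous.
apply/seteqP; split=> [_ [d Dd <-]|e Ee].
  have [e Ee ed] : E' (h (set_val d)) by apply: hD; exists d.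
  suff -> : restrict_complement hX d = e by [].
  exact/val_inj/esym.
have [d Dd de] : D' (g (set_val e)) by apply: gE; exists e.
by exists d => //; apply: val_inj => /=; rewrite -[RHS]gK; congr h.
Qed.

End complement.

Unset Implicit Arguments.

Theorem corollary4p6 (X : set cantor_space) (X_uncountable : ~ countable X)
    (X_saturated : saturated X) (X_lambda' : lambda'_set X) :
  countable_dense_homogeneous (set_type (~` X)) /\
  baire_space (set_type (~` X)) /\
  completely_baire (set_type (~` X)).
Proof.
split; last first.
  by split; [exact: complement_baire|exact: complement_completely_baire].
split; first exact: complement_separable.
exact: complement_homogeneous.
Qed.
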